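(* Let $\Gamma^1=(G_1,\sigma_1,\mu_1)$ and $\Gamma^2=(G_2,\sigma_2,\mu_2)$ be two balanced signed graphs and let $\theta$ be any $r$-orientation of the edges of $\Gamma^1$. Let $\star$ denote any one of the three products $\diamond$ (edge corona), $\boxdot$ (subdivision vertex neighbourhood corona) or $\boxminus$ (subdivision edge neighbourhood corona), all taken under $\theta$. Then $(\Gamma^1\star\Gamma^2)_\theta$ is unbalanced if and only if $\Gamma^2$ contains at least one edge of one of the following types: (a) a positive edge joining two vertices with opposite markings; (b) a negative edge joining two positively marked vertices; (c) a negative edge joining two negatively marked vertices.
   Context: A signed graph $\Gamma=(G,\sigma,\mu)$ consists of a finite simple undirected graph $G$, a signature $\sigma:E(G)\to\{+1,-1\}$ and a marking $\mu:V(G)\to\{+1,-1\}$. A signed graph is balanced if every cycle contains an even number of negative edges, and unbalanced otherwise. An $r$-orientation of $\Gamma=(G,\sigma)$ is a map $\theta:V(G)\times E(G)\to\{-1,0,1\}$ with $\theta(w,uv)=0$ if $w\notin\{u,v\}$, $\theta(u,uv)\in\{\pm1\}$ for an endpoint $u$ of $uv$, and $\theta(u,uv)\theta(v,uv)=\sigma(uv)$ for every edge $uv$. Let $\Gamma^1$ have vertices $v_1,\dots,v_{n_1}$ and edges $e_1,\dots,e_{m_1}$, and let $\Gamma^2$ have $n_2$ vertices. Edge corona $(\Gamma^1\diamond\Gamma^2)_\theta$: take $\Gamma^1$ and $m_1$ disjoint copies of $\Gamma^2$ (with the signs of $\Gamma^2$); for each $t$, each endpoint $u$ of $e_t$ and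 each vertex $w$ of the $t$-th copy, add an edge $uw$ with sign $\theta(u,e_t)\mu_2(w)$ (where $\mu_2(w)$ is the marking of the vertex of $\Gamma^2$ corresponding to $w$). Subdivision graph $S(\Gamma^1_\theta)$: insert a new vertex $v_{e}$ into every edge $e$ of $\Gamma^1$; the edge $v_iv_e$ ($v_i$ an endpoint of $e$) gets sign $\theta(v_i,e)$. Subdivision vertex neighbourhood corona $(\Gamma^1\boxdot\Gamma^2)_\theta$: take $S(\Gamma^1_\theta)$ and $n_1$ disjoint copies of $\Gamma^2$; for each $t$, each edge $e$ of $\Gamma^1$ incident to $v_t$ and each vertex $u$ of the $t$-th copy, add an edge $v_eu$ with sign $\theta(v_t,e)\mu_2(u)$. Subdivision edge neighbourhood corona $(\Gamma^1\boxminus\Gamma^2)_\theta$: take $S(\Gamma^1_\theta)$ and $m_1$ disjoint copies of $\Gamma^2$; for each $t$, each endpoint $v$ of $e_t$ and each vertex $u$ of the $t$-th copy, add an edge $vu$ with sign $\theta(v,e_t)\mu_2(u)$.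
   Formalization: The formal theorem additionally assumes that Γ¹ has at least one edge; for edgeless Γ¹ the claim fails, e.g. Γ¹ a single vertex and Γ² one negative edge joining two positively marked vertices, where every product is balanced. *)

(* Defs.v *)
From mathcomp Require Import all_boot all_order all_algebra.

Set Implicit Arguments.
Unset Strict Implicit.
Unset Printing Implicit Defensive.

Import GRing.Theory Num.Theory.

Local Open Scope ring_scope.

Definition is_sign (x : int) : Prop := x = 1 \/ x = -1.

(* The signature of an edge uv is [sgn u v]; [sgn] carries no information on
   pairs of nonadjacent vertices. *)
Record signed_graph := SignedGraph {
  vertex :> finType;
  adj : rel vertex;
  sgn : vertex -> vertex -> int;
  adj_sym : symmetric adj;
  adj_irr : irreflexive adj;
  sgn_sym : forall u v, adj u v -> sgn u v = sgn v u;
  sgn_sign : forall u v, adj u v -> is_sign (sgn u v)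
}.
Arguments adj : clear implicits.
Arguments sgn : clear implicits.

Record marked_signed_graph := MarkedSignedGraph {
  underlying :> signed_graph;
  mark : underlying -> int;
  mark_sign : forall u, is_sign (mark u)
}.
Arguments mark : clear implicits.

Definition edge_set (G : signed_graph) : {set {set G}} :=
  [set e : {set G} | [exists u, exists v, adj G u v && (e == [set u; v])]].

Definition edge (G : signed_graph) : finType := {e : {set G} | e \in edge_set G}.

Definition negative_edges (G : signed_graph) (c : seq G) : nat :=
  count (fun x => sgn G x (next c x) == -1) c.

(* A cycle is listed by its pairwise distinct vertices, at least three of them,
   each adjacent to the next one cyclically. *)
Definition balanced (G : signed_graph) : Prop :=
  forall c : seq G, (2 < size c)%N -> ucycle (adj G) c ->
    ~~ odd (negative_edges c).

Definition unbalanced (G : signed_graph) : Prop := ~ balanced G.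

Record r_orientation (G : signed_graph) := ROrientation {
  ori :> G -> edge G -> int;
  ori0 : forall w (e : edge G), w \notin val e -> ori w e = 0;
  ori_sign : forall u (e : edge G), u \in val e -> is_sign (ori u e);
  ori_sgn : forall u v (e : edge G), val e = [set u; v] -> ori u e * ori v e = sgn G u v
}.

Lemma is_signM x y : is_sign x -> is_sign y -> is_sign (x * y).
Proof.
by case=> -> [] ->; rewrite ?mul1r ?mulr1 ?mulrNN ?mulr1 /is_sign; auto.
Qed.

Section Subdivision.
Variables (G : signed_graph) (theta : r_orientation G).

Definition subdiv_adj (x y : G + edge G) : bool :=
  match x, y with
  | inl v, inr e | inr e, inl v => v \in val e
  | _, _ => false
  end.

Definition subdiv_sgn (x y : G + edge G) : int :=
  match x, y with
  | inl v, inr e | inr e, inl v => theta v e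
  | _, _ => 0
  end.

Fact subdiv_adj_sym : symmetric subdiv_adj.
Proof. by case=> x [] y. Qed.

Fact subdiv_adj_irr : irreflexive subdiv_adj.
Proof. by case. Qed.

Fact subdiv_sgn_sym x y : subdiv_adj x y -> subdiv_sgn x y = subdiv_sgn y x.
Proof. by case: x y => x [] y. Qed.

Fact subdiv_sgn_sign x y : subdiv_adj x y -> is_sign (subdiv_sgn x y).
Proof. by case: x y => x [] y //=; apply: ori_sign. Qed.

Definition subdivision : signed_graph :=
  SignedGraph subdiv_adj_sym subdiv_adj_irr subdiv_sgn_sym subdiv_sgn_sign.

End Subdivision.

(* The base graph [B] together with disjoint copies of [H] indexed by [I]; the
   vertex (i, w) of the i-th copy is joined to those x in [B] with [inc x i], by
   an edge of sign [s x i * mark w].  All three products are of this form. *)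
Section AttachCopies.
Variables (B : signed_graph) (I : finType) (H : marked_signed_graph).
Variables (inc : B -> I -> bool) (s : B -> I -> int).
Hypothesis s_sign : forall x i, inc x i -> is_sign (s x i).

Definition attach_adj (x y : B + I * H) : bool :=
  match x, y with
  | inl u, inl v => adj B u v
  | inl u, inr (i, _) | inr (i, _), inl u => inc u i
  | inr (i, w), inr (j, z) => (i == j) && adj H w z
  end.

Definition attach_sgn (x y : B + I * H) : int :=
  match x, y with
  | inl u, inl v => sgn B u v
  | inl u, inr (i, w) | inr (i, w), inl u => s u i * mark H w
  | inr (_, w), inr (_, z) => sgn H w z
  end.

Fact attach_adj_sym : symmetric attach_adj.
Proof.
case=> [u|[i w]] [v|[j z]] //=; first exact: adj_sym.
by rewrite eq_sym adj_sym.
Qed.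

Fact attach_adj_irr : irreflexive attach_adj.
Proof. by case=> [u|[i w]] /=; rewrite adj_irr ?andbF. Qed.

Fact attach_sgn_sym x y : attach_adj x y -> attach_sgn x y = attach_sgn y x.
Proof.
case: x y => [u|[i w]] [v|[j z]] //=; first exact: sgn_sym.
by case/andP=> _; apply: sgn_sym.
Qed.

Fact attach_sgn_sign x y : attach_adj x y -> is_sign (attach_sgn x y).
Proof.
case: x y => [u|[i w]] [v|[j z]] /=; first exact: sgn_sign.
- by move=> /s_sign h; apply: is_signM h (mark_sign z).
- by move=> /s_sign h; apply: is_signM h (mark_sign w).
- by case/andP=> _; apply: sgn_sign.
Qed.

Definition attach_copies : signed_graph :=
  SignedGraph attach_adj_sym attach_adj_irr attach_sgn_sym attach_sgn_sign.

End AttachCopies.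

Section Coronas.
Variables (G : signed_graph) (theta : r_orientation G) (H : marked_signed_graph).

Definition edge_corona : signed_graph :=
  @attach_copies G (edge G) H (fun u e => u \in val e) theta
    (@ori_sign G theta).

Definition svn_inc (x : subdivision theta) (t : G) : bool :=
  match x with inl _ => false | inr e => t \in val e end.

Definition svn_sgn (x : subdivision theta) (t : G) : int :=
  match x with inl _ => 0 | inr e => theta t e end.

Fact svn_sgn_sign x t : svn_inc x t -> is_sign (svn_sgn x t).
Proof. by case: x => //= e; apply: ori_sign. Qed.

Definition subdivision_vertex_neighbourhood_corona : signed_graph :=
  @attach_copies (subdivision theta) G H svn_inc svn_sgn svn_sgn_sign.

Definition sen_inc (x : subdivision theta) (e : edge G) : bool :=
  match x with inl v => v \in val e | inr _ => false end.

Definition sen_sgn (x : subdivision theta) (e : edge G) : int :=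
  match x with inl v => theta v e | inr _ => 0 end.

Fact sen_sgn_sign x e : sen_inc x e -> is_sign (sen_sgn x e).
Proof. by case: x => //= v; apply: ori_sign. Qed.

Definition subdivision_edge_neighbourhood_corona : signed_graph :=
  @attach_copies (subdivision theta) (edge G) H sen_inc sen_sgn sen_sgn_sign.

End Coronas.

Variant product_kind :=
  | EdgeCorona
  | SubdivisionVertexNeighbourhoodCorona
  | SubdivisionEdgeNeighbourhoodCorona.

Definition product (star : product_kind) (G : signed_graph)
    (theta : r_orientation G) (H : marked_signed_graph) : signed_graph :=
  match star with
  | EdgeCorona => edge_corona theta H
  | SubdivisionVertexNeighbourhoodCorona =>
      subdivision_vertex_neighbourhood_corona theta H
  | SubdivisionEdgeNeighbourhoodCorona =>
      subdivision_edge_neighbourhood_corona theta H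
  end.

(* Main.v *)
Require Import Defs.
From mathcomp Require Import all_boot all_order all_algebra.
From mathcomp Require Import zify.

(** By Harary's theorem, a signed graph is balanced iff it admits a potential
    [f] with values in {1, -1} such that every edge uv has sign [f u * f v].
    If every edge wz of the second factor has sign [mark w * mark z], i.e. is
    of none of the types (a)-(c), then a potential [f] of the first factor
    extends to the product: on the vertex of an edge e it takes the value
    [f u * theta u e], which does not depend on the endpoint u of e, and on a
    copy of w it is the value at the edge or vertex indexing the copy, times
    [mark w].  Conversely, an edge wz of one of the types (a)-(c) forms a
    negative triangle with any base vertex attached to a copy of it. *)

Set Implicit Arguments.
Unset Strict Implicit.
Unset Printing Implicit Defensive.

Import GRing.Theory Num.Theory.

Local Open Scope ring_scope.

Lemma is_sign_sqr (x : int) : is_sign x -> x * x = 1.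
Proof. by case=> ->. Qed.

Lemma is_signE (x : int) : is_sign x -> x = (-1) ^+ (x == -1).
Proof. by case=> ->. Qed.

Section Walks.
Variable G : signed_graph.
Implicit Types (x y : G) (p q : seq G).

Fixpoint walk_sgn x p : int :=
  if p is y :: p' then sgn G x y * walk_sgn y p' else 1.

Lemma walk_sgn_cat x p q :
  walk_sgn x (p ++ q) = walk_sgn x p * walk_sgn (last x p) q.
Proof. by elim: p x => [|y p IHp] x /=; rewrite ?mul1r // IHp mulrA. Qed.

Lemma walk_sgn_sign x p : path (adj G) x p -> is_sign (walk_sgn x p).
Proof.
elim: p x => [|y p IHp] x /=; first by left.
by case/andP=> /sgn_sign xy /IHp; apply: is_signM.
Qed.

(** The closing vertex [y0] is kept apart from the head [y] so that induction can move the head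
    along the list; uniqueness makes each successor lookup in the tail skip [y]. *)
Lemma prod_next_at y0 y p : uniq (y :: p) ->
  \prod_(z <- y :: p) sgn G z (next_at z y0 y p) = walk_sgn y (rcons p y0).
Proof.
elim: p y => [|y' p IHp] y; first by rewrite big_seq1 /= eqxx mulr1.
move=> /= /andP[yNp Up]; rewrite big_cons /= eqxx -IHp //; congr (_ * _).
apply: eq_big_seq => z zp; case: eqP => // zy.
by rewrite zy (negPf yNp) in zp.
Qed.

Lemma signr_negative_edges x p : ucycle (adj G) (x :: p) ->
  (-1) ^+ negative_edges (x :: p) = walk_sgn x (rcons p x).
Proof.
case/andP=> cyc Up; rewrite -prod_next_at //.
rewrite /negative_edges -sum1_count big_mkcond -prodrXr.
apply: eq_big_seq => z zp.
have /sgn_sign/is_signE {2}-> := next_cycle cyc zp.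
by rewrite /=; case: eqP.
Qed.

Lemma not_uniq_split p : ~~ uniq p ->
  exists p1 y p2 p3, p = p1 ++ y :: p2 ++ y :: p3.
Proof.
elim: p => //= x p IHp; case: (boolP (x \in p)) => [/splitPr[p2 p3] _|_ /=].
  by exists [::], x, p2, p3.
by case/IHp=> p1 [y [p2 [p3 ->]]]; exists (x :: p1), y, p2, p3.
Qed.

(** Induction on length. Without a repeated vertex the walk is a cycle, is empty, or runs along an
    edge and back; otherwise it splits at a repetition into two shorter closed walks. *)
Lemma closed_walk_sgn x p : balanced G ->
  path (adj G) x p -> last x p = x -> walk_sgn x p = 1.
Proof.
move=> bal; have [n] := ubnP (size p); elim: n => // n IHn in x p *.
case/lastP: p => // q z; rewrite size_rcons last_rcons ltnS => lt_qn + zx.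
rewrite {z}zx => pq; case: (boolP (uniq (x :: q))) => [Uq | /not_uniq_split].
  case: (ltnP 1 (size q)) => [gt1 | le1].
    have cyc : ucycle (adj G) (x :: q) by apply/andP; split.
    rewrite -signr_negative_edges // -signr_odd.
    by rewrite (negPf (bal _ _ cyc)).
  case: q le1 pq {lt_qn Uq} => [|y [|//]] _ /=; first by rewrite adj_irr.
  case/andP=> xy _; rewrite mulr1 -(sgn_sym xy).
  exact: is_sign_sqr (sgn_sign xy).
(* Either the base point [x] recurs, or a later vertex [y] does. *)
case=> -[|x' p1] [y [p2 [p3]]] /= [].
  move=> <- def_q; rewrite {q}def_q size_cat /= in lt_qn pq *.
  move: pq; rewrite rcons_cat /= -cat_rcons cat_path last_rcons.
  case/andP=> pp2 pp3; rewrite walk_sgn_cat last_rcons.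
  by rewrite !IHn ?last_rcons ?size_rcons //; lia.
move=> _ def_q; rewrite {q}def_q size_cat /= size_cat /= in lt_qn pq *.
move: pq; rewrite rcons_cat /= rcons_cat /= -cat_rcons -(cat_rcons y p2).
rewrite !cat_path !last_rcons => /and3P[pp1 pp2 pp3].
rewrite !walk_sgn_cat !last_rcons (IHn y (rcons p2 y)) ?last_rcons //;
  last first.
  by rewrite size_rcons; lia.
(* With the loop at [y] removed, the two outer pieces join into a shorter closed walk at [x]. *)
rewrite mul1r -{2}(last_rcons x p1 y) -walk_sgn_cat IHn //.
- by rewrite size_cat !size_rcons; lia.
- by rewrite cat_path pp1 last_rcons.
- by rewrite last_cat !last_rcons.
Qed.

End Walks.

Definition is_potential (G : signed_graph) (f : G -> int) : Prop :=
  (forall u, is_sign (f u)) /\ forall u v, adj G u v -> sgn G u v = f u * f v.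

(** The potential at [v] is the sign of a chosen walk to [v] from the root of its component. *)
Lemma balanced_potential (G : signed_graph) :
  balanced G -> exists f : G -> int, is_potential f.
Proof.
move=> bal; have Gsym : connect_sym (adj G) by apply/sym_connect_sym/adj_sym.
pose r := fingraph.root (adj G).
pose is_walk v p := path (adj G) (r v) p && (last (r v) p == v).
have walkP v : exists p, is_walk v p.
  have /connectP[p pp ->] : connect (adj G) (r v) v.
    by rewrite Gsym connect_root.
  exists p; rewrite /is_walk.
  have -> : r (last (r v) p) = r v.
    transitivity (r (r v)); last exact: fingraph.root_root.
    by apply/esym/(fingraph.rootP Gsym)/connectP; exists p.
  by rewrite pp eqxx.
pose w v := xchoose (walkP v).
have wP v : path (adj G) (r v) (w v) /\ last (r v) (w v) = v.
  by have /andP[? /eqP] := xchooseP (walkP v).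
exists (fun v => walk_sgn (r v) (w v)); split=> [v|u v uv].
  by apply: walk_sgn_sign; have [] := wP v.
have [[pu lu] [pv lv]] := (wP u, wP v).
have ruv : r u = r v by apply/(fingraph.rootP Gsym)/connect1.
(* The same return walk [q] closes both the walk to [v] and the walk to [u] prolonged by the edge
   [uv]; comparing the two closed walks gives the sign of [uv]. *)
have /connectP[q pq lq] := connect_root (adj G) v.
have Hv : walk_sgn (r v) (w v) * walk_sgn v q = 1.
  have := @closed_walk_sgn G (r v) (w v ++ q) bal.
  by rewrite walk_sgn_cat cat_path last_cat lv pv pq -lq => ->.
have Hu : walk_sgn (r u) (w u) * (sgn G u v * walk_sgn v q) = 1.
  have := @closed_walk_sgn G (r u) (w u ++ v :: q) bal.
  by rewrite walk_sgn_cat cat_path last_cat lu /= pu uv pq -lq ruv => ->.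
have sq := is_sign_sqr (walk_sgn_sign pq).
have su := is_sign_sqr (walk_sgn_sign pu).
have -> : walk_sgn (r v) (w v) = walk_sgn v q.
  by rewrite -[LHS]mulr1 -sq mulrA Hv mul1r.
rewrite -[LHS]mulr1 -sq mulrA -[LHS]mul1r -su.
by rewrite !mulrA -(mulrA (_ * _) (sgn _ _ _)) -(mulrA (walk_sgn _ _)) Hu mulr1.
Qed.

(** Along a walk the potentials of inner vertices occur twice and cancel, leaving only those of the
    two ends. *)
Lemma potential_balanced (G : signed_graph) (f : G -> int) :
  is_potential f -> balanced G.
Proof.
case=> f_sign fE [|x p] // _ cyc.
have walkE y q : path (adj G) y q -> walk_sgn y q = f y * f (last y q).
  elim: q y => [|z q IHq] y /=; first by rewrite is_sign_sqr.
  case/andP=> /fE-> /IHq->.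
  by rewrite mulrA -(mulrA (f y)) is_sign_sqr ?mulr1.
have := signr_negative_edges cyc; rewrite walkE; last by case/andP: cyc.
by rewrite last_rcons is_sign_sqr // -signr_odd; case: odd.
Qed.

Section AttachCopies.
Variables (B : signed_graph) (I : finType) (H : marked_signed_graph).
Variables (inc : B -> I -> bool) (s : B -> I -> int).
Hypothesis s_sign : forall x i, inc x i -> is_sign (s x i).

(** The factor [g i] rescales the marking on the [i]-th copy: it is squared away on edges inside the
    copy and yields the prescribed sign on edges to the base. *)
Lemma attach_copies_balanced (f : B -> int) (g : I -> int) :
    is_potential f -> is_potential (mark H) -> (forall i, is_sign (g i)) ->
    (forall x i, inc x i -> s x i = f x * g i) ->
  balanced (attach_copies H s_sign).
Proof.
case=> f_sign fE [_ markE] g_sign sE.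
pose h (x : B + I * H) :=
  match x with inl u => f u | inr (i, w) => g i * mark H w end.
apply: (@potential_balanced (attach_copies H s_sign) h); split.
  by case=> [u|[i w]] //=; apply: is_signM (g_sign i) (mark_sign w).
case=> [u|[i w]] [v|[j z]] /=; first exact: fE.
- by move=> /sE->; rewrite mulrA.
- by move=> /sE->; rewrite -mulrA mulrC.
- case/andP=> /eqP <- /markE->.
  by rewrite mulrACA is_sign_sqr ?mul1r.
Qed.

(** In the triangle on [x], [(i, w)], [(i, z)] the sign [s x i] occurs twice, so the product is
    [sgn H w z * mark H w * mark H z], which is -1. *)
Lemma attach_copies_unbalanced x i (w z : H) :
    inc x i -> adj H w z -> sgn H w z <> mark H w * mark H z ->
  unbalanced (attach_copies H s_sign).
Proof.
move=> xi wz bad bal.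
pose K := attach_copies H s_sign.
pose a : K := inl x; pose b : K := inr (i, w); pose c : K := inr (i, z).
have pabc : path (adj K) a [:: b; c; a] by rewrite /= xi eqxx wz.
have := closed_walk_sgn bal pabc erefl; rewrite /= mulr1.
move: bad; case: (s_sign xi) (sgn_sign wz) => -> [] ->.
all: by case: (mark_sign w) (mark_sign z) => -> [] -> //= [].
Qed.

End AttachCopies.

Lemma edge_endpoint (G : signed_graph) (e : edge G) : {u | u \in val e}.
Proof.
apply: sigW; case: e => e /=; rewrite inE => /existsP[u /existsP[v]].
by case/andP=> _ /eqP->; exists u; rewrite !inE eqxx.
Qed.

(** For the two ends of [e], both [theta a e * theta b e] and [f a * f b] equal the sign of [e]. *)
Lemma potential_edge (G : signed_graph) (theta : r_orientation G) f
    (e : edge G) u v : is_potential f -> u \in val e -> v \in val e ->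
  f u * theta u e = f v * theta v e.
Proof.
case=> f_sign fE.
have key a b : val e = [set a; b] -> adj G a b ->
    f a * theta a e = f b * theta b e.
  move=> def_e ab; have := ori_sgn theta def_e; rewrite fE // => thE.
  have /(ori_sign theta)/is_sign_sqr tb : b \in val e
    by rewrite def_e !inE eqxx orbT.
  rewrite -[f a * _]mulr1 -tb mulrA -[f a * _ * _]mulrA thE mulrA.
  by rewrite is_sign_sqr ?mul1r.
have := valP e; rewrite inE => /existsP[a /existsP[b /andP[ab /eqP def_e]]].
by rewrite def_e !inE => /orP[] /eqP-> /orP[] /eqP-> //; rewrite (key a b).
Qed.

Lemma subdivision_potential (G : signed_graph) (theta : r_orientation G)
    (f : G -> int) (g : edge G -> int) :
    is_potential f -> (forall e, is_sign (g e)) ->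
    (forall u (e : edge G), u \in val e -> theta u e = f u * g e) ->
  @is_potential (subdivision theta)
    (fun x => match x with inl u => f u | inr e => g e end).
Proof.
case=> f_sign _ g_sign gE; split; first by case.
by case=> [u|e] [v|e'] //= /gE // ->; rewrite mulrC.
Qed.

Lemma sgn_neq_marks (H : marked_signed_graph) (u v : H) : adj H u v ->
  sgn H u v <> mark H u * mark H v <->
    [\/ sgn H u v = 1 /\ mark H u = - mark H v,
        [/\ sgn H u v = -1, mark H u = 1 & mark H v = 1]
      | [/\ sgn H u v = -1, mark H u = -1 & mark H v = -1]].
Proof.
move=> /sgn_sign uv; split.
  case: uv => ->; case: (mark_sign u) (mark_sign v) => -> [] -> //= _.
  - by constructor 1.
  - by constructor 1.
  - by constructor 2.
  - by constructor 3.
case=> [[-> ->]|[-> -> ->]|[-> -> ->]] //.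
by rewrite mulNr is_sign_sqr //; apply: mark_sign.
Qed.

Theorem theorem3p1 (G1 G2 : marked_signed_graph) (theta : r_orientation G1)
    (star : product_kind)
    (edge_G1 : exists u v : G1, adj G1 u v)
    (bal_G1 : balanced G1) (bal_G2 : balanced G2) :
  unbalanced (product star theta G2) <->
  exists u v : G2, adj G2 u v /\
    [\/ sgn G2 u v = 1 /\ mark G2 u = - mark G2 v,
        [/\ sgn G2 u v = -1, mark G2 u = 1 & mark G2 v = 1]
      | [/\ sgn G2 u v = -1, mark G2 u = -1 & mark G2 v = -1]].
Proof.
split=> [unbal | [w [z [wz /(sgn_neq_marks wz) bad]]]].
  case: (boolP [exists w, exists z,
      adj G2 w z && (sgn G2 w z != mark G2 w * mark G2 z)]).
    case/existsP=> w /existsP[z /andP[wz /eqP bad]].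
    by exists w, z; split=> //; apply/sgn_neq_marks.
  move=> good; case: unbal.
  have potH : is_potential (mark G2).
    split=> [w|w z wz]; first exact: mark_sign.
    apply/eqP; apply: contraNT good => bad.
    by apply/existsP; exists w; apply/existsP; exists z; rewrite wz.
  have [f potf] := balanced_potential bal_G1; have [f_sign _] := potf.
  pose g e := let u := sval (edge_endpoint e) in f u * theta u e.
  have g_sign e : is_sign (g e).
    by apply: is_signM => //; apply: ori_sign; apply: svalP (edge_endpoint e).
  have gE u (e : edge G1) : u \in val e -> theta u e = f u * g e.
    move=> ue; have := potential_edge theta potf (svalP (edge_endpoint e)) ue.
    rewrite /g => ->; rewrite mulrA.
    by rewrite is_sign_sqr ?mul1r.
  have potS := subdivision_potential potf g_sign gE.
  (* For the vertex neighbourhood corona the roles swap: copies are indexed by vertices and carry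
     [f], while the inserted base vertices carry [g]. *)
  case: star => /=.
  - exact: (attach_copies_balanced potf potH g_sign gE).
  - apply: (attach_copies_balanced potS potH f_sign).
    by case=> // e t /gE /= ->; rewrite mulrC.
  - by apply: (attach_copies_balanced potS potH g_sign); case.
(* An edge of the first factor provides a copy together with a base vertex attached to it, the apex
   of the negative triangle. *)
have [u [v uv]] := edge_G1.
have eP : [set u; v] \in edge_set G1.
  by rewrite inE; apply/existsP; exists u; apply/existsP; exists v; rewrite uv /=.
pose e : edge G1 := exist _ [set u; v] eP.
have ue : u \in val e by rewrite !inE eqxx.
case: star => /=.
- exact: (@attach_copies_unbalanced _ _ _ _ _ (@ori_sign _ theta) u e
    _ _ ue wz bad).
- exact: (@attach_copies_unbalanced _ _ _ _ _ (@svn_sgn_sign _ theta) (inr e) u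
    _ _ ue wz bad).
- exact: (@attach_copies_unbalanced _ _ _ _ _ (@sen_sgn_sign _ theta) (inl u) e
    _ _ ue wz bad).
Qed.
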